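(* Let $d\geqslant 4$ be an even integer and let $n$ be a positive integer with $n\equiv -1\pmod{d}$. Then \[ \sum_{k=0}^{n-1}[2dk+1]\frac{(q;q^d)_k^d}{(q^d;q^d)_k^d}q^{\frac{d(d-3)k}{2}} \equiv 0\pmod{\Phi_n(q)^2}. \]
   Context: $q$ is an indeterminate. The $q$-shifted factorial is $(a;q)_k=(1-a)(1-aq)\cdots(1-aq^{k-1})$ (with $(a;q)_0=1$). For any integer $m$, $[m]=(1-q^m)/(1-q)$. $\Phi_n(q)$ denotes the $n$-th cyclotomic polynomial. A congruence of rational functions modulo a polynomial $P(q)$, where the denominators are coprime to $P(q)$, means that $P(q)$ divides the numerator of the difference in lowest terms. *)

(* Defs.v *)
From HB Require Import structures.
From mathcomp Require Import all_boot all_order all_algebra all_field.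
Set Implicit Arguments. Unset Strict Implicit. Unset Printing Implicit Defensive.
Import Order.TTheory GRing.Theory Num.Theory.
Local Open Scope ring_scope.

Notation RF := {fraction {poly rat}}.
Notation toRF := (@FracField.tofrac ({poly rat} : idomainType)).

Definition qF : RF := toRF 'X.

Definition qpoch (R : comRingType) (a q : R) (k : nat) : R :=
  \prod_(i < k) (1 - a * q ^+ i).

Definition qint (m : nat) : RF := (1 - qF ^+ m) / (1 - qF).

Definition PhiQ (n : nat) : {poly rat} := map_poly (intr : int -> rat) ('Phi_n).

Definition cong_mod (f g : RF) (P : {poly rat}) : Prop :=
  exists a b : {poly rat},
    coprimep b P /\ b != 0 /\ f - g = toRF (P * a) / toRF b.

(* Main.v *)
Require Import Defs.
From HB Require Import structures.
From mathcomp Require Import all_boot all_order all_algebra all_field.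
From mathcomp Require Import ring zify.
Import Order.TTheory GRing.Theory Num.Theory.
Local Open Scope ring_scope.

(** Write [n + 1 = d r], [M = n - r], [p = q^d], so that [q p^M = q^((d-1)n)].
    The summands with [k > M] are divisible by [Phi_n^d]. Modulo [Phi_n^2], two of
    the factors [q] of [(q;p)_k^d] may be replaced by [q^(1-(d-1)n)] and
    [q^(1+(d-1)n)] (and likewise in the denominator), because
    [(1 - x y)(1 - x / y) = (1 - x)^2 - x (1 - y)^2 / y]. The new sum terminates
    at [M] by itself, and [q^(1-(d-1)n) = p^(-M)] makes its very-well-poised part
    the Lagrange weights of the nodes [x_k = p^(-k) + q p^k], [0 <= k <= M]: up to
    a factor divisible by [Phi_n] the sum is a divided difference of order [M].
    The remaining factors form [d/2 - 1] well-poised pairs, each of which is, by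
    the q-Saalschuetz formula, a polynomial in [x_k] with coefficients integral at
    [Phi_n] and of degree at most [r - 1] modulo [Phi_n]. As
    [(d/2 - 1)(r - 1) < M], the divided difference vanishes modulo [Phi_n], which
    yields the second factor. *)

(** * Shifted factorials and the q-Saalschuetz sum *)

Lemma qpoch0 {R : comNzRingType} (a q : R) : qpoch a q 0 = 1.
Proof. by rewrite /qpoch big_ord0. Qed.

Lemma qpochS {R : comNzRingType} (a q : R) k :
  qpoch a q k.+1 = qpoch a q k * (1 - a * q ^+ k).
Proof. by rewrite /qpoch big_ord_recr. Qed.

Lemma qpochSl {R : comNzRingType} (a q : R) k :
  qpoch a q k.+1 = (1 - a) * qpoch (a * q) q k.
Proof.
rewrite /qpoch big_ord_recl expr0 mulr1; congr (_ * _).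
by apply: eq_bigr => i _; rewrite /bump /= exprS mulrA.
Qed.

Lemma qpoch_Vexp_eq0 {F : fieldType} (p : F) k j :
  p != 0 -> (k < j)%N -> qpoch (p ^- k) p j = 0.
Proof.
move=> p0 kj; rewrite /qpoch (bigD1 (Ordinal kj)) //=.
by rewrite mulVf ?expf_neq0 // subrr mul0r.
Qed.

(** The [j]-th term of the terminating 3phi2 series with upper parameters p^(-k), a p^k, [e], lower
    parameters [B], [C] and argument [p]; it is balanced when [B * C = a * p * e]. *)
Definition saal_term {F : fieldType} (p a e B C : F) (k j : nat) : F :=
  qpoch (p ^- k) p j * qpoch (a * p ^+ k) p j * qpoch e p j * p ^+ j
  / (qpoch p p j * qpoch B p j * qpoch C p j).

(* Zeilberger's recurrence in [k] for the q-Saalschuetz sum: the right-hand side is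
   the certificate, which vanishes for [j > k]. *)
Lemma saal_telescope {F : fieldType} (p a e B C : F) (k j : nat) :
    p != 0 -> B * C = a * p * e ->
    qpoch p p j != 0 -> qpoch B p j != 0 -> qpoch C p j != 0 ->
  \sum_(i < j.+1)
     ((1 - B * p ^+ k) * (1 - C * p ^+ k) * saal_term p a e B C k.+1 i
      - (e - (B + C) * p ^+ k + a * p * p ^+ k ^+ 2) * saal_term p a e B C k i)
  = (1 - a * p * p ^+ k ^+ 2)
    * (qpoch (p ^- k) p j * qpoch (a * p ^+ k.+1) p j * qpoch e p j.+1
       / (qpoch p p j * qpoch B p j * qpoch C p j)).
Proof.
move=> p0 bal; have Q0 : p ^+ k != 0 by rewrite expf_neq0.
elim: j => [|j IHj].
  rewrite big_ord1 /saal_term !qpochS !qpoch0 !expr0 => _ _ _.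
  rewrite !mulr1 !mul1r invr1 !mulr1.
  have -> : (1 - B * p ^+ k) * (1 - C * p ^+ k)
    = 1 - (B + C) * p ^+ k + (B * C) * p ^+ k ^+ 2 by ring.
  by rewrite bal; ring.
rewrite big_ord_recr /= !(qpochS p p) !(qpochS B) !(qpochS C) !mulf_eq0 !negb_or.
move=> /andP[pj0 p1] /andP[Bj0 B1] /andP[Cj0 C1].
rewrite {}IHj // /saal_term (qpochSl (p ^- k.+1)) (qpochSl (a * p ^+ k)).
have -> : p ^- k.+1 * p = p ^- k by rewrite exprS invfM mulrAC mulVf // mul1r.
rewrite -(mulrA a (p ^+ k) p) -exprSr.
rewrite !(qpochS (p ^- k)) !(qpochS (a * p ^+ k.+1)) !(qpochS e).
rewrite !(qpochS p) !(qpochS B) !(qpochS C) !(exprS p).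
set Q := p ^+ k in Q0 *; set J := p ^+ j in p1 B1 C1 *.
move: (qpoch (Q^-1) p j) (qpoch (a * (p * Q)) p j) (qpoch e p j) => X Y Z.
move: (qpoch p p j) (qpoch B p j) (qpoch C p j) pj0 Bj0 Cj0 => U V W U0 V0 W0.
by field: bal; repeat (apply/andP; split).
Qed.

Lemma qpoch_neq0_le {R : idomainType} {a q : R} {j k : nat} :
  (j <= k)%N -> qpoch a q k != 0 -> qpoch a q j != 0.
Proof.
move=> jk; rewrite /qpoch !prodf_seq_neq0 => /allP h; apply/allP => i _ /=.
by have := h (widen_ord jk i); rewrite mem_index_enum => /(_ isT).
Qed.

(** The hypotheses encode B = a p / b, C = a p / c and e = a p / (b c) without division, so the
    right-hand side is a well-poised pair. They split the coefficient of the recurrence as e (1 - b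
    p^k) (1 - c p^k), and induction on [k] gives the product. *)
Lemma q_saalschutz {F : fieldType} (p a b c e B C : F) (k : nat) :
    p != 0 -> a * p = b * B -> B = c * e -> C = b * e ->
    qpoch p p k != 0 -> qpoch B p k != 0 -> qpoch C p k != 0 ->
  \sum_(j < k.+1) saal_term p a e B C k j
  = qpoch b p k * qpoch c p k / (qpoch B p k * qpoch C p k) * e ^+ k.
Proof.
move=> p0 eB ee eC; elim: k => [|k IHk].
  move=> _ _ _; rewrite big_ord1 /saal_term !qpoch0 !expr0.
  by rewrite !(mulr1, mul1r, invr1).
move=> pk Bk Ck.
have pk' := qpoch_neq0_le (leqnSn k) pk.
have Bk' := qpoch_neq0_le (leqnSn k) Bk.
have Ck' := qpoch_neq0_le (leqnSn k) Ck.
have bal : B * C = a * p * e by rewrite eB eC; ring.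
have := saal_telescope p a e B C k k.+1 p0 bal pk Bk Ck.
(* At [j = k.+1] the certificate contains (p^(-k); p)_(k+1) = 0. *)
rewrite (qpoch_Vexp_eq0 _ _ _ p0) // !mul0r mulr0 sumrB -!mulr_sumr => /eqP.
rewrite subr_eq0 => /eqP.
have -> : \sum_(i < k.+2) saal_term p a e B C k i
        = \sum_(i < k.+1) saal_term p a e B C k i.
  by rewrite big_ord_recr /= {2}/saal_term qpoch_Vexp_eq0 // !mul0r addr0.
rewrite IHk // !qpochS.
move: Bk Ck; rewrite !qpochS !mulf_eq0 !negb_or => /andP[_ B1] /andP[_ C1].
have -> : e - (B + C) * p ^+ k + a * p * p ^+ k ^+ 2
        = e * (1 - b * p ^+ k) * (1 - c * p ^+ k) by rewrite eB eC ee; ring.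
move=> h; apply: (mulfI (mulf_neq0 B1 C1)); rewrite h exprS.
by field; repeat (apply/andP; split).
Qed.

(** * Newton polynomials at the nodes *)

(* The nodes are [x_i = p ^- i + a * p ^+ i]: up to a unit, this is the Newton
   polynomial [\prod_(i < j) ('X - x_i)]. *)
Definition newton {F : fieldType} (p a : F) (j : nat) : {poly F} :=
  \prod_(i < j) ((1 + a * p ^+ i ^+ 2)%:P - (p ^+ i) *: 'X).

Definition node {F : fieldType} (p a : F) (k : nat) : F := p ^- k + a * p ^+ k.

(** Since (1 - p^(i-k)) (1 - a p^(i+k)) = 1 + a p^(2i) - p^i x_k, a q-Saalschuetz term depends on
    [k] only through a polynomial in x_k. *)
Lemma newton_node {F : fieldType} (p a : F) (j k : nat) : p != 0 ->
  (newton p a j).[node p a k] = qpoch (p ^- k) p j * qpoch (a * p ^+ k) p j.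
Proof.
move=> p0; rewrite /newton horner_prod /qpoch -big_split /=.
apply: eq_bigr => i _; rewrite hornerD hornerN hornerC hornerZ hornerX /node.
have : p ^+ k != 0 by rewrite expf_neq0.
move: (p ^+ k) (p ^+ i) => Q J Q0 /=; by field.
Qed.

Lemma size_newton {F : fieldType} (p a : F) j : (size (newton p a j) <= j.+1)%N.
Proof.
elim: j => [|j IHj]; rewrite /newton ?big_ord0 ?size_poly1 //.
rewrite big_ord_recr /=; apply: leq_trans (size_polyMleq _ _) _.
suff: (size ((1 + a * p ^+ j ^+ 2)%:P - (p ^+ j) *: 'X)%R <= 2)%N.
  by move=> h; have := leq_sub2r 1 (leq_add IHj h); rewrite !subn1 addn2.
apply: leq_trans (size_polyD _ _) _; rewrite geq_max size_polyN.
rewrite (leq_trans (size_polyC_leq1 _)) //=.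
by apply: leq_trans (size_scale_leq _ _) _; rewrite size_polyX.
Qed.

(** * Divided differences as very-well-poised sums *)

(* Up to a factor independent of [k], [lag_weight p a N k] is the Lagrange weight
   [1 / \prod_(j <= N | j != k) (x_k - x_j)], so [lag] is a multiple of the divided
   difference at [x_0, ..., x_N]. *)
Definition lag_weight {F : fieldType} (p a : F) (N k : nat) : F :=
  (1 - a * p ^+ k ^+ 2) / (1 - a)
  * (qpoch a p k * qpoch (p ^- N) p k)
  / (qpoch p p k * qpoch (a * p ^+ N.+1) p k) * p ^+ N ^+ k.

Definition lag {F : fieldType} (p a : F) (N : nat) (f : nat -> F) : F :=
  \sum_(k < N.+1) lag_weight p a N k * f k.

(** The weights telescope. At [k = N > 0] the factor (p^(1-N); p)_k vanishes, so divided differences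
    annihilate constants. *)
Lemma lag_weight_sum {F : fieldType} (p a : F) (N k : nat) :
    p != 0 -> 1 - a != 0 ->
    qpoch p p k != 0 -> qpoch (a * p ^+ N.+1) p k != 0 ->
  \sum_(i < k.+1) lag_weight p a N i
  = qpoch (a * p) p k * qpoch (p ^- N * p) p k
    / (qpoch p p k * qpoch (a * p ^+ N.+1) p k) * p ^+ N ^+ k.
Proof.
move=> p0 a1; have Q0 : p ^+ N != 0 by rewrite expf_neq0.
elim: k => [|k IHk].
  rewrite big_ord1 /lag_weight !qpoch0 !expr0 => _ _.
  by rewrite expr1n !(mulr1, mul1r, invr1) mulfV.
rewrite big_ord_recr /=; rewrite !(qpochS p p) !(qpochS (a * p ^+ N.+1)).
rewrite !mulf_eq0 !negb_or => /andP[pk p1] /andP[ak a2].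
rewrite {}IHk // /lag_weight (qpochSl a) (qpochSl (p ^- N)).
rewrite !(qpochS p) !(qpochS (a * _)) !(qpochS (_ * p)) !exprS.
move: (qpoch (a * p) p k) (qpoch (p ^- N * p) p k) => X Y.
move: pk ak p1 a2; rewrite exprS.
move: (qpoch p p k) (qpoch _ p k) => U V.
move: (p ^+ k) (p ^+ N ^+ k) (p ^+ N) Q0 => K K' Q Q0 U0 V0 h1 h2.
by field; repeat (apply/andP; split).
Qed.

Lemma lag1 {F : fieldType} (p a : F) (N : nat) :
    p != 0 -> 1 - a != 0 -> (0 < N)%N ->
    qpoch p p N != 0 -> qpoch (a * p ^+ N.+1) p N != 0 ->
  lag p a N (fun=> 1) = 0.
Proof.
move=> p0 a1 N0 pN aN; rewrite /lag; under eq_bigr do rewrite mulr1.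
rewrite lag_weight_sum //; case: N N0 {pN aN} => // N _.
have -> : p ^- N.+1 * p = p ^- N by rewrite exprS invfM mulrAC mulVf // mul1r.
by rewrite qpoch_Vexp_eq0 // mulr0 !mul0r.
Qed.

(** A factor x - x_(N+1) cancels the last node of a divided difference. The constant equals x_0 -
    x_(N+1), because the weights are normalized to 1 at [k = 0]. *)
Lemma lag_node {F : fieldType} (p a : F) (N : nat) (f : nat -> F) :
    p != 0 -> qpoch p p N.+1 != 0 -> qpoch (a * p ^+ N.+1) p N.+2 != 0 ->
  lag p a N.+1 (fun k => (node p a k - node p a N.+1) * f k)
  = (1 - p ^- N.+1) * (1 - a * p ^+ N.+1) * lag p a N f.
Proof.
move=> p0 pN aN; rewrite /lag big_ord_recr /= subrr mul0r mulr0 addr0 mulr_sumr.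
apply: eq_bigr => k _; rewrite mulrA [RHS]mulrA; congr (_ * _).
have kN : (k <= N)%N by rewrite -ltnS.
have Q0 : p ^+ N != 0 by rewrite expf_neq0.
have K0 : p ^+ k != 0 by rewrite expf_neq0.
have pk := qpoch_neq0_le (leqW kN) pN.
have ak : qpoch (a * p ^+ N.+1) p k.+1 != 0 by apply: qpoch_neq0_le aN; lia.
have := ak; rewrite qpochS mulf_eq0 negb_or => /andP[{}ak _].
have ak' : qpoch (a * p ^+ N.+2) p k != 0.
  have -> : a * p ^+ N.+2 = a * p ^+ N.+1 * p by rewrite -mulrA -exprSr.
  have : qpoch (a * p ^+ N.+1) p k.+1 != 0 by apply: qpoch_neq0_le aN; lia.
  by rewrite qpochSl mulf_eq0 negb_or => /andP[].
(* Splitting off the first or the last factor of a shifted factorial of length [k.+1] relates the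
   weights of order [N.+1] to those of order [N]. *)
have h1 := qpochS (p ^- N.+1) p k; rewrite qpochSl in h1.
have h2 := qpochS (a * p ^+ N.+1) p k; rewrite qpochSl in h2.
have eN : p ^- N.+1 * p = p ^- N by rewrite exprS invfM mulrAC mulVf // mul1r.
rewrite {}eN in h1; rewrite -mulrA -exprSr in h2.
rewrite /lag_weight /node [in p ^+ N.+1 ^+ k]exprS exprMn.
move: ((1 - _) / (1 - a)) => w.
move: ak ak' h1 h2; rewrite !exprS.
move: (qpoch _ p k) (qpoch _ p k) => V' V.
move: (qpoch (p * p ^+ N)^-1 p k) (qpoch (p ^- N) p k) => X Y.
move: (qpoch a p k) (qpoch p p k) pk => T U.
move: (p ^+ k) (p ^+ N) (p ^+ N ^+ k) K0 Q0 => K Q Z K0 Q0 U0 V0 V0' h1 h2.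
have h3 : (1 - a * (p * Q) * K) / V' = (1 - a * (p * Q)) / V.
  by apply/eqP; rewrite eqr_div // h2 mulrC.
transitivity (w * T / U * Z * (X * (1 - (p * Q)^-1 * K))
              * ((1 - a * (p * Q) * K) / V')).
  by field; repeat (apply/andP; split).
by rewrite h3 -h1; field; repeat (apply/andP; split).
Qed.

(** * Valuations of rational functions *)

(* [vge P m x]: the [P]-adic valuation of [x] is at least [m], i.e. [x] is [P ^+ m]
   times an element of the localization of [{poly rat}] at [P]. *)
Definition vge (P : {poly rat}) (m : nat) (x : RF) : Prop :=
  exists u v : {poly rat},
    [/\ coprimep v P, v != 0 & x = toRF (P ^+ m * u) / toRF v].

Section Valuation.
Variable P : {poly rat}.
Implicit Types (m i j : nat) (x y : RF).

Lemma vge_poly m u : vge P m (toRF (P ^+ m * u)).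
Proof. by exists u, 1; rewrite coprime1p oner_eq0 rmorph1 divr1. Qed.

Lemma vge0 m : vge P m 0.
Proof. by have := vge_poly m 0; rewrite mulr0 rmorph0. Qed.

Lemma vge1 : vge P 0 1.
Proof. by have := vge_poly 0 1; rewrite mulr1 rmorph1. Qed.

Lemma vgeD m x y : vge P m x -> vge P m y -> vge P m (x + y).
Proof.
move=> [u [v [cv v0 ->]]] [w [z [cz z0 ->]]].
exists (u * z + w * v), (v * z); split; rewrite ?coprimepMl ?cv ?mulf_neq0 //.
by rewrite addf_div ?tofrac_eq0 // -!rmorphM -rmorphD mulrDr !mulrA.
Qed.

Lemma vgeM i j x y : vge P i x -> vge P j y -> vge P (i + j) (x * y).
Proof.
move=> [u [v [cv v0 ->]]] [w [z [cz z0 ->]]].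
exists (u * w), (v * z); split; rewrite ?coprimepMl ?cv ?mulf_neq0 //.
by rewrite mulf_div -!rmorphM exprD mulrACA.
Qed.

Lemma vge_le i j x : (j <= i)%N -> vge P i x -> vge P j x.
Proof.
move=> ji [u [v [cv v0 ->]]]; exists (P ^+ (i - j) * u), v; split=> //.
by rewrite mulrA -exprD subnKC.
Qed.

Lemma vgeMr m x y : vge P m x -> vge P 0 y -> vge P m (x * y).
Proof. by move=> hx hy; have := vgeM _ _ _ _ hx hy; rewrite addn0. Qed.

Lemma vgeMl m x y : vge P 0 x -> vge P m y -> vge P m (x * y).
Proof. by rewrite mulrC => hx hy; exact: vgeMr. Qed.

Lemma vgeN m x : vge P m x -> vge P m (- x).
Proof.
move=> hx; rewrite -mulrN1; apply: vgeMr => //.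
by have := vge_poly 0 (-1); rewrite mul1r rmorphN rmorph1.
Qed.

Lemma vgeB m x y : vge P m x -> vge P m y -> vge P m (x - y).
Proof. by move=> hx hy; apply: vgeD => //; exact: vgeN. Qed.

Lemma vge_sum m (I : Type) (r : seq I) (Q : pred I) (f : I -> RF) :
  (forall k, Q k -> vge P m (f k)) -> vge P m (\sum_(i <- r | Q i) f i).
Proof.
by move=> hf; elim/big_ind: _ => //; [exact: vge0 | exact: vgeD].
Qed.

Lemma vge_prod (I : Type) (r : seq I) (Q : pred I) (f : I -> RF) :
  (forall k, Q k -> vge P 0 (f k)) -> vge P 0 (\prod_(i <- r | Q i) f i).
Proof.
by move=> hf; elim/big_ind: _ => //; [exact: vge1 | exact: (@vgeM 0 0)].
Qed.

Lemma vgeX m j x : vge P m x -> vge P (m * j) (x ^+ j).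
Proof.
move=> hx; elim: j => [|j IHj]; first by rewrite muln0 expr0; exact: vge1.
by rewrite mulnS exprS; exact: vgeM.
Qed.

Lemma vge_tofracV v : coprimep v P -> v != 0 -> vge P 0 (toRF v)^-1.
Proof. by move=> cv v0; exists 1, v; split; rewrite // mulr1 rmorph1 div1r. Qed.

End Valuation.

(** * Cyclotomic polynomials over the rationals *)

(** Coprimality may be tested over [algC], where the roots of Phi_n are the primitive [n]-th roots
    of unity. *)
Lemma coprimep_PhiQ (n : nat) (v : {poly rat}) : (0 < n)%N ->
    (forall x : algC, n.-primitive_root x -> (map_poly ratr v).[x] != 0) ->
  coprimep v (PhiQ n).
Proof.
move=> n0 hv; have [z zn] := C_prim_root_exists n0.
rewrite coprimep_sym -(coprimep_map (@ratr algC)) /PhiQ -map_poly_comp /=.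
rewrite (eq_map_poly (g := intr)) => [|i /=]; last by rewrite ratr_int.
rewrite (Cintr_Cyclotomic zn); apply/Pdiv.ClosedField.coprimepP => x.
by rewrite (root_cyclotomic zn) => /hv.
Qed.

Lemma coprimep_XnB1_PhiQ (n m : nat) : (0 < n)%N -> ~~ (n %| m)%N ->
  coprimep (1 - 'X^m) (PhiQ n).
Proof.
move=> n0 nm; apply: coprimep_PhiQ => // x xn.
rewrite rmorphB rmorph1 /= map_polyXn hornerD hornerN hornerC hornerXn.
by rewrite subr_eq0 eq_sym -(prim_order_dvd xn).
Qed.

Lemma coprimep_Xn_PhiQ (n m : nat) : (0 < n)%N -> coprimep 'X^m (PhiQ n).
Proof.
move=> n0; apply: coprimep_PhiQ => // x xn.
rewrite /= map_polyXn hornerXn expf_neq0 //; apply/eqP => x0.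
have /eqP := prim_expr_order xn.
by rewrite x0 expr0n gtn_eqF // eq_sym oner_eq0.
Qed.

Lemma PhiQ_dvd_XnB1 (n m : nat) : (0 < n)%N -> (n %| m)%N ->
  exists u, 1 - 'X^m = PhiQ n * u.
Proof.
move=> n0 /dvdnP[t ->].
have [u hu] : exists u, 'X^n - 1 = PhiQ n * u.
  have := congr1 (map_poly (intr : int -> rat)) (prod_Cyclotomic n0).
  rewrite rmorphB rmorph1 /= map_polyXn => <-.
  rewrite (big_rem n) ?divisors_id //= rmorphM /=.
  by eexists.
exists (u * - \sum_(i < t) 'X^n ^+ i).
by rewrite mulrA mulrN -hu -subrX1 mulnC exprM opprB.
Qed.

Lemma qF_neq0 : qF != 0.
Proof. by rewrite tofrac_eq0 polyX_eq0. Qed.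

Lemma qFXn m : qF ^+ m = toRF 'X^m.
Proof. by rewrite rmorphXn. Qed.

(** * Integrality at Phi_n of powers of q and of shifted factorials *)

Section Cyclotomic.
Variables n d : nat.
Hypothesis n_gt0 : (0 < n)%N.
Local Notation Phi := (PhiQ n).

Lemma vge_qFz (z : int) : vge Phi 0 (qF ^ z).
Proof.
case: z => m.
  by rewrite -exprnP qFXn; have := vge_poly Phi 0 'X^m; rewrite expr0 mul1r.
rewrite NegzE -exprnN qFXn; apply: vge_tofracV; first exact: coprimep_Xn_PhiQ.
exact/monic_neq0/monicXn.
Qed.

(** Reduces negative exponents to positive ones, up to a unit at Phi_n. *)
Lemma qFz_opp (z : int) : 1 - qF ^ (- z) = - qF ^ (- z) * (1 - qF ^ z).
Proof.
rewrite mulrBr mulr1 mulNr -expfzDr ?qF_neq0 // addNr expr0z.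
by rewrite opprK addrC.
Qed.

Lemma one_subqFX m : 1 - qF ^+ m = toRF (1 - 'X^m).
Proof. by rewrite rmorphB rmorph1 qFXn. Qed.

Lemma one_subXn_neq0 m : (0 < m)%N -> (1 - 'X^m : {poly rat}) != 0.
Proof.
by move=> m0; rewrite -oppr_eq0 opprB -size_poly_eq0 size_XnsubC.
Qed.

Lemma one_subqFz_neq0 (z : int) : z != 0 -> 1 - qF ^ z != 0.
Proof.
have pos m : (0 < m)%N -> 1 - qF ^+ m != 0.
  by move=> m0; rewrite one_subqFX tofrac_eq0 one_subXn_neq0.
case: z => m; first by case: m => // m _; exact: pos.
move=> _; rewrite NegzE qFz_opp mulf_neq0 ?pos //.
by rewrite oppr_eq0 expfz_neq0 ?qF_neq0.
Qed.

Lemma vge_one_subqFz (z : int) : vge Phi 0 (1 - qF ^ z).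
Proof. by apply: vgeB; [exact: vge1 | exact: vge_qFz]. Qed.

Lemma vge_one_subqFzV (z : int) : ~~ (n %| z)%Z -> vge Phi 0 (1 - qF ^ z)^-1.
Proof.
have pos m : ~~ (n %| m)%N -> vge Phi 0 (1 - qF ^+ m)^-1.
  move=> nm; rewrite one_subqFX; apply: vge_tofracV.
    exact: coprimep_XnB1_PhiQ.
  by apply: one_subXn_neq0; case: m nm => //; rewrite dvdn0.
case: z => m; first exact: pos.
rewrite NegzE dvdzE abszN => nm; rewrite qFz_opp invfM invrN invr_expz opprK.
by apply: vgeMr; [apply/vgeN/vge_qFz | exact: pos].
Qed.

Lemma vge1_one_subqFz (z : int) : (n %| z)%Z -> vge Phi 1 (1 - qF ^ z).
Proof.
have pos m : (n %| m)%N -> vge Phi 1 (1 - qF ^+ m).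
  move=> nm; rewrite one_subqFX.
  have [u ->] := PhiQ_dvd_XnB1 n m n_gt0 nm.
  by have := vge_poly Phi 1 u; rewrite expr1.
case: z => m; first exact: pos.
rewrite NegzE dvdzE abszN => nm; rewrite qFz_opp.
by apply: vgeMl; [apply/vgeN/vge_qFz | exact: pos].
Qed.

Lemma qpoch_qFz (z : int) k :
  qpoch (qF ^ z) (qF ^+ d) k = \prod_(i < k) (1 - qF ^ (z + (d * i)%N)).
Proof.
by apply: eq_bigr => i _; rewrite expfzDr ?qF_neq0 // -exprnP -exprM.
Qed.

Lemma vge_qpoch (z : int) k : vge Phi 0 (qpoch (qF ^ z) (qF ^+ d) k).
Proof. by rewrite qpoch_qFz; apply: vge_prod => i _; exact: vge_one_subqFz. Qed.

Lemma vge1_qpoch (z : int) k i : (i < k)%N -> (n %| z + (d * i)%N)%Z ->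
  vge Phi 1 (qpoch (qF ^ z) (qF ^+ d) k).
Proof.
move=> ik nz; rewrite qpoch_qFz (bigD1 (Ordinal ik)) //=.
apply: vgeMr; first exact: vge1_one_subqFz.
by apply: vge_prod => j _; exact: vge_one_subqFz.
Qed.

Lemma vge_qpochV (z : int) k :
    (forall i, (i < k)%N -> ~~ (n %| z + (d * i)%N)%Z) ->
  vge Phi 0 (qpoch (qF ^ z) (qF ^+ d) k)^-1.
Proof.
move=> nz; rewrite qpoch_qFz -prodfV.
by apply: vge_prod => i _; apply: vge_one_subqFzV; exact: nz.
Qed.

Lemma qpoch_qFz_neq0 (z : int) k :
    (forall i, (i < k)%N -> z + (d * i)%N != 0) ->
  qpoch (qF ^ z) (qF ^+ d) k != 0.
Proof.
move=> nz; rewrite qpoch_qFz prodf_seq_neq0; apply/allP => i _ /=.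
by rewrite one_subqFz_neq0 // nz.
Qed.

Definition polyint (P : {poly RF}) := forall i, vge Phi 0 P`_i.

Lemma polyint_sum (I : Type) (r : seq I) (Q : pred I) (f : I -> {poly RF}) :
    (forall k, Q k -> polyint (f k)) ->
  polyint (\sum_(i <- r | Q i) f i).
Proof. by move=> hf i; rewrite coef_sum; apply: vge_sum => k /hf. Qed.

Lemma polyintD (P Q : {poly RF}) : polyint P -> polyint Q -> polyint (P + Q).
Proof. by move=> hP hQ i; rewrite coefD; exact: vgeD. Qed.

Lemma polyintZ c (P : {poly RF}) : vge Phi 0 c -> polyint P -> polyint (c *: P).
Proof. by move=> hc hP i; rewrite coefZ; exact: vgeMr. Qed.

Lemma polyintM (P Q : {poly RF}) : polyint P -> polyint Q -> polyint (P * Q).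
Proof.
by move=> hP hQ i; rewrite coefM; apply: vge_sum => j _; exact: vgeMr.
Qed.

Lemma polyintC c : vge Phi 0 c -> polyint c%:P.
Proof. by move=> hc i; rewrite coefC; case: eqP => // _; exact: vge0. Qed.

Lemma polyintX : polyint 'X.
Proof. by move=> i; rewrite coefX; case: eqP => _; [exact: vge1 | exact: vge0]. Qed.

Lemma polyint_newton j : polyint (newton (qF ^+ d) qF j).
Proof.
rewrite /newton; elim/big_ind: _; first exact/polyintC/vge1; first exact: polyintM.
move=> i _; rewrite -scaleNr; apply: polyintD.
  apply: polyintC; apply: vgeD; first exact: vge1.
  by rewrite -!exprM -exprS; exact: (vge_qFz (Posz _)).
apply: polyintZ; last exact: polyintX.
by apply: vgeN; rewrite -exprM; exact: (vge_qFz (Posz _)).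
Qed.
End Cyclotomic.

(** * Divided differences of polynomials *)

Section LagrangePoly.
Variables (F : fieldType) (p a : F).
Hypotheses (p0 : p != 0) (a1 : 1 - a != 0).
Hypothesis pp0 : forall k, qpoch p p k != 0.
Hypothesis ap0 : forall N k, qpoch (a * p ^+ N.+1) p k != 0.

Definition lag_poly (N : nat) (P : {poly F}) : F :=
  lag p a N (fun k => P.[node p a k]).

Lemma lag_poly0 P : lag_poly 0 P = P.[node p a 0].
Proof.
rewrite /lag_poly /lag big_ord1 /lag_weight /= !qpoch0 !expr0 expr1n !mulr1.
by rewrite divr1 mulfV ?mul1r.
Qed.

Lemma lag_polyD N P Q c :
  lag_poly N (P + c *: Q) = lag_poly N P + c * lag_poly N Q.
Proof.
rewrite /lag_poly /lag mulr_sumr -big_split; apply: eq_bigr => k _ /=.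
by rewrite hornerD hornerZ mulrDr mulrCA.
Qed.

(** In Q X + c = (X - x_(N+1)) Q + x_(N+1) Q + c the first summand loses a node and the constant is
    annihilated. The inductions on polynomials below use this recurrence. *)
Lemma lag_polyMXaddC N Q c :
  lag_poly N.+1 (Q * 'X + c%:P)
  = (1 - p ^- N.+1) * (1 - a * p ^+ N.+1) * lag_poly N Q
    + node p a N.+1 * lag_poly N.+1 Q.
Proof.
rewrite -lag_node // -[c%:P]mulr1 mul_polyC lag_polyD.
have -> : lag_poly N.+1 1 = 0.
  rewrite /lag_poly -[RHS](lag1 p a N.+1) //.
  by apply: eq_bigr => k _; rewrite hornerC.
rewrite mulr0 addr0 /lag_poly /lag mulr_sumr -big_split; apply: eq_bigr => k _ /=.
by rewrite hornerMX; ring.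
Qed.

(** One term of the recurrence lowers order and degree together, the other lowers only the degree;
    both vanish by induction. *)
Lemma lag_poly_eq0 N (P : {poly F}) : (size P <= N)%N -> lag_poly N P = 0.
Proof.
elim/poly_ind: P N => [|Q c IHQ] N.
  by move=> _; rewrite /lag_poly /lag big1 // => k _; rewrite horner0 mulr0.
have [-> |Q0] := eqVneq Q 0.
  rewrite mul0r add0r; case: N => [|N].
    by rewrite size_poly_leq0 => /eqP ->; rewrite lag_poly0 horner0.
  move=> _; rewrite -[c%:P]add0r -[X in X + _](mul0r 'X) lag_polyMXaddC.
  rewrite /lag_poly /lag !big1 ?mulr0 ?addr0 // => k _;
    by rewrite horner0 mulr0.
rewrite size_MXaddC (negPf Q0) /=; case: N => [//|N] sQ.
by rewrite lag_polyMXaddC !IHQ ?mulr0 ?addr0 // ltnW.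
Qed.
End LagrangePoly.

(** * Nonvanishing of the denominators for p = q^d and a = q *)

Section Nonvanishing.
Variable d : nat.
Hypothesis d_gt0 : (0 < d)%N.
Local Notation p := (qF ^+ d).

Lemma p_neq0 : p != 0. Proof. by rewrite expf_neq0 ?qF_neq0. Qed.

Lemma qpoch_pp_neq0 k : qpoch p p k != 0.
Proof. by rewrite (qpoch_qFz_neq0 d (Posz d)) // => i _; lia. Qed.

Lemma qpoch_qp_neq0 N k : qpoch (qF * p ^+ N.+1) p k != 0.
Proof.
rewrite -exprM -exprS exprnP.
by apply: qpoch_qFz_neq0 => i _; lia.
Qed.

Lemma one_subqF_neq0 : 1 - qF != 0.
Proof. exact: (one_subqFz_neq0 1). Qed.

End Nonvanishing.

(** * Divided differences modulo powers of Phi_n *)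

Section CyclotomicLag.
Variables n d : nat.
Hypothesis n_gt0 : (0 < n)%N.
Hypothesis d_gt0 : (0 < d)%N.
Local Notation Phi := (PhiQ n).
Local Notation p := (qF ^+ d).
Local Notation x := (node p qF).
Local Notation L := (lag_poly RF p qF).

Lemma vge_node k : vge Phi 0 (x k).
Proof.
rewrite /node -exprM -exprS exprnN; apply: vgeD; first exact: vge_qFz.
exact: (vge_qFz n n_gt0 (Posz _)).
Qed.

Lemma vge_lag_factor N :
  vge Phi 0 (1 - p ^- N.+1) /\ vge Phi 0 (1 - qF * p ^+ N.+1).
Proof.
rewrite -!exprM -exprS exprnN; split; first exact: vge_one_subqFz.
exact: (vge_one_subqFz n n_gt0 (Posz _)).
Qed.

Let lagS := lag_polyMXaddC RF p qF (p_neq0 d) one_subqF_neq0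
  (qpoch_pp_neq0 d d_gt0) (qpoch_qp_neq0 d d_gt0).

Lemma polyint_MXaddC (Q : {poly RF}) c :
  polyint n (Q * 'X + c%:P) -> polyint n Q /\ vge Phi 0 c.
Proof.
move=> h; split; last by have := h 0%N; rewrite coefD coefMX coefC add0r.
by move=> i; have := h i.+1; rewrite coefD coefMX coefC addr0.
Qed.

Lemma vge_horner (P : {poly RF}) y : polyint n P -> vge Phi 0 y -> vge Phi 0 P.[y].
Proof.
move=> hP hy; rewrite horner_coef; apply: vge_sum => i _; apply: vgeMr => //.
by rewrite -(mul0n i); exact: vgeX.
Qed.

(** The constants and nodes in the recurrence are integral, so the denominators of the single
    weights need not be examined. *)
Lemma vge_lag_poly N (P : {poly RF}) : polyint n P -> vge Phi 0 (L N P).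
Proof.
elim/poly_ind: P N => [|Q c IHQ] N.
  move=> _; rewrite /lag_poly /lag big1 => [|k _]; first exact: vge0.
  by rewrite horner0 mulr0.
case: N => [|N] hP.
  rewrite lag_poly0 ?one_subqF_neq0 //.
  by apply: vge_horner => //; exact: vge_node.
have [hQ _] := polyint_MXaddC _ _ hP; have [k1 k2] := vge_lag_factor N.
rewrite lagS; apply: vgeD; apply: vgeMr; [|exact: IHQ| |exact: IHQ].
  exact: vgeMr.
exact: vge_node.
Qed.

(** In the recurrence the term of lower order carries the factor 1 - q^(1 + d N), divisible by
    Phi_n; the other keeps the order and falls to induction. This supplies one of the two factors
    Phi_n. *)
Lemma vge1_lag_poly N (P : {poly RF}) : (0 < N)%N ->
  (n %| (1 + d * N)%N)%N -> polyint n P -> vge Phi 1 (L N P).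
Proof.
case: N => // N _ nN; elim/poly_ind: P => [|Q c IHQ].
  move=> _; rewrite /lag_poly /lag big1 => [|k _]; first exact: vge0.
  by rewrite horner0 mulr0.
move=> hP; have [hQ _] := polyint_MXaddC _ _ hP; have [k1 k2] := vge_lag_factor N.
rewrite lagS; apply: vgeD; last by apply: vgeMl; [exact: vge_node | exact: IHQ].
apply: vgeMr; last exact: vge_lag_poly.
apply: vgeMl => //; rewrite -exprM -exprS -add1n.
exact: (vge1_one_subqFz n n_gt0 (Posz _)).
Qed.

(* [f] agrees on the nodes [0..M] with an integral polynomial in [x] whose
   reduction modulo [Phi] has degree at most [s]. *)
Definition nodepoly (M s : nat) (f : nat -> RF) : Prop :=
  exists P0 P1 : {poly RF},
    [/\ polyint n P0, polyint n P1, (size P0 <= s.+1)%N &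
        forall k, (k <= M)%N -> f k = P0.[x k] + toRF Phi * P1.[x k]].

Lemma vge_Phi : vge Phi 1 (toRF Phi).
Proof. by have := vge_poly Phi 1 1; rewrite expr1 mulr1. Qed.

Lemma PhiQ_neq0 : Phi != 0.
Proof. exact/monic_neq0/monic_map/Cyclotomic_monic. Qed.

Lemma vge_divPhi y : vge Phi 1 y -> vge Phi 0 (y / toRF Phi).
Proof.
move=> [u [v [cv v0 ->]]]; exists u, v; split=> //.
rewrite expr0 mul1r expr1 rmorphM /= mulrAC [X in X / _]mulrAC.
by rewrite divff ?mul1r // tofrac_eq0 PhiQ_neq0.
Qed.

Lemma eq_nodepoly M s f g : (forall k, (k <= M)%N -> f k = g k) ->
  nodepoly M s f -> nodepoly M s g.
Proof.
move=> fg [P0 [P1 [iP0 iP1 sP0 hf]]]; exists P0, P1; split=> // k kM.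
by rewrite -fg // hf.
Qed.

Lemma nodepolyM M s t f g : nodepoly M s f -> nodepoly M t g ->
  nodepoly M (s + t) (fun k => f k * g k).
Proof.
move=> [P0 [P1 [iP0 iP1 sP0 hf]]] [Q0 [Q1 [iQ0 iQ1 sQ0 hg]]].
have iPhi : vge Phi 0 (toRF Phi) by apply: vge_le vge_Phi.
(* Every product but [P0 * Q0] carries a factor [Phi], so only its degree counts. *)
exists (P0 * Q0), (P0 * Q1 + P1 * Q0 + toRF Phi *: (P1 * Q1)); split.
- exact: polyintM.
- by apply: polyintD; [apply: polyintD | apply: polyintZ => //]; exact: polyintM.
- have := leq_sub2r 1 (leq_add sP0 sQ0); rewrite addSn addnS !subn1 /=.
  by move=> h; apply: leq_trans (size_polyMleq _ _) h.
move=> k kM; rewrite hf // hg //.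
rewrite !(hornerD, hornerM, hornerZ).
have alg (K : fieldType) (u v w z e : K) :
  (u + e * v) * (w + e * z) = u * w + e * (u * z + v * w + e * (v * z)) by ring.
exact: alg.
Qed.

Lemma nodepoly1 M : nodepoly M 0 (fun=> 1).
Proof.
exists 1%:P, 0%:P; split; first exact/polyintC/vge1; first exact/polyintC/vge0.
  exact: size_polyC_leq1.
have alg (K : fieldType) (e y : K) : 1 = (1%:P).[y] + e * (0%:P).[y].
  by rewrite !hornerC mulr0 addr0.
by move=> k _; exact: alg.
Qed.

Lemma nodepolyX M s j f : nodepoly M s f -> nodepoly M (s * j) (fun k => f k ^+ j).
Proof.
move=> hf; elim: j => [|j IHj]; first by rewrite muln0; exact: nodepoly1.
rewrite mulnS; apply: eq_nodepoly (nodepolyM _ _ _ _ _ hf IHj) => k _.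
by rewrite exprS.
Qed.

(** The degree bound makes the contribution of [P0] vanish; what remains is [Phi] times a divided
    difference itself divisible by [Phi]. *)
Lemma vge2_lag M s f : (s < M)%N -> (n %| (1 + d * M)%N)%N -> nodepoly M s f ->
  vge Phi 2 (lag p qF M f).
Proof.
move=> sM nM [P0 [P1 [iP0 iP1 sP0 hf]]].
have -> : lag p qF M f = L M (P0 + toRF Phi *: P1).
  apply: eq_bigr => k _; rewrite hf; last by rewrite -ltnS.
  by rewrite hornerD hornerZ.
rewrite lag_polyD lag_poly_eq0 ?(leq_trans sP0) //.
- rewrite add0r; apply: (vgeM _ 1 1); first exact: vge_Phi.
  by apply: vge1_lag_poly => //; exact: leq_trans sM.
- exact: p_neq0.
- exact: one_subqF_neq0.
- exact: qpoch_pp_neq0.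
- exact: qpoch_qp_neq0.
Qed.
End CyclotomicLag.

(** * Well-poised pairs as polynomials in the node *)

Section Pairs.
Variables n d r : nat.
Hypothesis n_gt0 : (0 < n)%N.
Hypothesis d_gt3 : (3 < d)%N.
Hypothesis ndr : n.+1 = (d * r)%N.
Local Notation Phi := (PhiQ n).
Local Notation p := (qF ^+ d).
Local Notation x := (node p qF).
Local Notation M := (n - r)%N.

Let d_gt0 : (0 < d)%N. Proof. exact: leq_trans d_gt3. Qed.
Let r_gt0 : (0 < r)%N. Proof. by case: r ndr; lia. Qed.

Lemma n_gt2 : (2 < n)%N.
Proof. by have := leq_pmulr d r_gt0; rewrite -ndr; lia. Qed.

Lemma coprime_nd : coprime n d.
Proof. by have := coprimenS n; rewrite ndr coprimeMr => /andP[]. Qed.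

(** Modulo [n] the exponent is d (i + 1), and [d] is coprime to [n] because n + 1 = d r. This makes
    the denominators units at Phi_n. *)
Lemma ndvd_dmul (s : int) i : (i.+1 < n)%N ->
  ~~ (n %| d%:Z + s * n + (d * i)%N)%Z.
Proof.
move=> iN; have -> : d%:Z + s * n + (d * i)%N = s * n + (d * i.+1)%N by lia.
rewrite rpredDl ?dvdz_mull ?dvdzz // dvdzE /=.
by rewrite Gauss_dvdr ?coprime_nd // gtnNdvd.
Qed.

(* The well-poised pair with parameters [q] and [q ^ (1 + s * n)]; the latter is
   [q] modulo [q ^ n - 1]. *)
Definition wp_pair (s : int) (k : nat) : RF :=
  qpoch (qF ^ (1 + s * n)) p k * qpoch qF p k
  / (qpoch (qF ^ (d%:Z - s * n)) p k * qpoch p p k)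
  * (qF ^ (d%:Z - 1 - s * n)) ^+ k.

(** The part of the q-Saalschuetz term independent of [k], for a = c = q and b = q^(1 + s n). *)
Definition wp_coef (s : int) (j : nat) : RF :=
  qpoch (qF ^ (d%:Z - 1 - s * n)) p j * p ^+ j
  / (qpoch p p j * qpoch (qF ^ (d%:Z - s * n)) p j * qpoch p p j).

Lemma r_le_M : (r <= M.+1)%N. Proof. nia. Qed.
Lemma r_lt_n : (r < n)%N. Proof. nia. Qed.

Lemma ltn_of_leM j : (j <= M)%N -> (j < n)%N. Proof. lia. Qed.

Lemma vge_qpochBV (s : int) j : (j < n)%N ->
  vge Phi 0 (qpoch (qF ^ (d%:Z + s * n)) p j)^-1.
Proof.
by move=> jn; apply: vge_qpochV => // i ij; apply: ndvd_dmul; lia.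
Qed.

Lemma qpochB_neq0 (s : int) j : (j < n)%N ->
  qpoch (qF ^ (d%:Z + s * n)) p j != 0.
Proof.
move=> jn; apply: qpoch_qFz_neq0 => // i ij.
by apply: contraTneq (ndvd_dmul s i _) => [->|]; rewrite ?dvdz0 //; lia.
Qed.

Lemma vge_qpochpV j : (j < n)%N -> vge Phi 0 (qpoch p p j)^-1.
Proof. by move/(vge_qpochBV 0); rewrite mul0r addr0. Qed.

Lemma vge_wp_coef s j : (j <= M)%N -> vge Phi 0 (wp_coef s j).
Proof.
move=> /ltn_of_leM jn; rewrite /wp_coef !invfM; apply: vgeMr.
  apply: vgeMr; first exact: vge_qpoch.
  by rewrite -exprM; exact: (vge_qFz n n_gt0 (Posz _)).
apply: vgeMr; last exact: vge_qpochpV.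
apply: vgeMr; first exact: vge_qpochpV.
by rewrite -mulNr; exact: vge_qpochBV.
Qed.

(** The factor of index r - 1 in (q^(d-1-sn); p)_j has exponent d r - 1 - s n = (1 - s) n. This caps
    the degree modulo Phi_n at r - 1. *)
Lemma vge1_wp_coef s j : (r <= j)%N -> (j <= M)%N -> vge Phi 1 (wp_coef s j).
Proof.
move=> rj /ltn_of_leM jn; rewrite /wp_coef !invfM; apply: vgeMr.
  apply: vgeMr; last by rewrite -exprM; exact: (vge_qFz n n_gt0 (Posz _)).
  apply: (vge1_qpoch n d n_gt0 _ _ r.-1); first by lia.
  have -> : d%:Z - 1 - s * n + (d * r.-1)%N = (1 - s) * n.
    by have : (d * r.-1 + d = n.+1)%N; [nia | lia].
  exact: dvdz_mull.
apply: vgeMr; last exact: vge_qpochpV.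
apply: vgeMr; first exact: vge_qpochpV.
by rewrite -mulNr; exact: vge_qpochBV.
Qed.

(** The q-Saalschuetz formula, read from right to left. *)
Lemma wp_pair_newton s k : (k <= M)%N ->
  wp_pair s k = \sum_(j < M.+1) (wp_coef s j *: newton p qF j).[x k].
Proof.
move=> kM; have kn := ltn_of_leM _ kM.
have p0 := p_neq0 d.
have := q_saalschutz p qF (qF ^ (1 + s * n)) qF (qF ^ (d%:Z - 1 - s * n))
  (qF ^ (d%:Z - s * n)) p k p0.
rewrite /wp_pair => <-; last first.
- by have := qpochB_neq0 0 k kn; rewrite mul0r addr0.
- by rewrite -mulNr qpochB_neq0.
- by have := qpochB_neq0 0 k kn; rewrite mul0r addr0.
- rewrite -expfzDr ?qF_neq0 // exprnP; congr (_ ^ _); lia.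
- rewrite -{2}[qF]expr1z -expfzDr ?qF_neq0 //; congr (_ ^ _); lia.
- rewrite -exprS exprnP -expfzDr ?qF_neq0 //; congr (_ ^ _); lia.
set T := saal_term p qF _ _ p k.
(* (p^(-k); p)_j = 0 for j > k, so the range can be made independent of [k] and one polynomial
   serves all nodes. *)
have -> : \sum_(j < k.+1) T j = \sum_(j < M.+1) T j.
  rewrite (big_ord_widen M.+1 T) // [RHS](bigID (fun j : 'I__ => j < k.+1)%N) /=.
  rewrite [X in _ = _ + X]big1 ?addr0 // => j; rewrite -leqNgt => kj.
  by rewrite /T /saal_term qpoch_Vexp_eq0 // !mul0r.
apply: eq_bigr => j _; rewrite hornerZ newton_node // /T /saal_term /wp_coef.
have alg (K : fieldType) (u v w y z : K) : u * v * w * y / z = w * y / z * (u * v).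
  by ring.
exact: alg.
Qed.

(** The expansion is cut at [j = r]: below, the Newton polynomials have degree at most r - 1; from
    there on the coefficients are divisible by [Phi]. *)
Lemma nodepoly_wp_pair s : nodepoly n d M r.-1 (wp_pair s).
Proof.
exists (\sum_(0 <= j < r) wp_coef s j *: newton p qF j).
exists (\sum_(r <= j < M.+1) (wp_coef s j / toRF Phi) *: newton p qF j).
split.
- rewrite big_seq_cond; apply: polyint_sum => j /andP[]; rewrite mem_index_iota => jr _.
  apply: polyintZ; last exact: polyint_newton.
  by apply: vge_wp_coef; have := r_le_M; lia.
- rewrite big_seq_cond; apply: polyint_sum => j /andP[]; rewrite mem_index_iota => jr _.
  apply: polyintZ; last exact: polyint_newton.
  by apply: vge_divPhi; apply: vge1_wp_coef; lia.
- rewrite big_seq_cond; elim/big_ind: _ => [|P Q hP hQ|j].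
  + by rewrite size_poly0.
  + by apply: leq_trans (size_polyD _ _) _; rewrite geq_max hP.
  rewrite mem_index_iota => /andP[jr _].
  apply: leq_trans (size_scale_leq _ _) _.
  by apply: leq_trans (size_newton _ _ _) _; lia.
move=> k kM; rewrite wp_pair_newton // -(big_mkord xpredT
  (fun j => (wp_coef s j *: newton p qF j).[x k])).
rewrite (big_cat_nat _ r_le_M) //= -!horner_sum; congr (_ + _).
rewrite -hornerZ scaler_sumr; congr (_.[_]); apply: eq_bigr => j _.
by rewrite scalerA mulrCA divff ?mulr1 // tofrac_eq0 PhiQ_neq0.
Qed.
End Pairs.

(** * Comparison with the modified sum modulo Phi_n^2 *)

(** Here d = 2 (h + 2), [A] is (q; p)_k and [D] is (p; p)_k; [al], [ga] are the numerators starting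
    at q^(1 - s n), q^(1 + s n), and [be], [de] the denominators starting at q^(d + s n), q^(d - s
    n). *)
Lemma wp_term_diff {F : fieldType} (w A D al be ga de Z1 Z2 Z3 : F) (h : nat) :
    D != 0 -> be != 0 -> de != 0 ->
  w * A ^+ h.+2.*2 / D ^+ h.+2.*2 * (Z1 * (Z2 ^+ h * Z3))
  - w * (A * al) / (D * be) * Z1 * ((A * A / (D * D) * Z2) ^+ h * (ga * A / (de * D) * Z3))
  = w * (Z1 * (Z2 ^+ h * Z3)) * (A * D^-1) ^+ h.+1.*2
    * ((be * de * A ^+ 2 - al * ga * D ^+ 2) * (D^-1 * D^-1 * be^-1 * de^-1)).
Proof.
move=> D0 be0 de0.
have e2 (x : F) m : x ^+ m.*2 = x ^+ m * x ^+ m by rewrite -addnn exprD.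
have Dh0 : D ^+ h != 0 by rewrite expf_neq0.
rewrite !e2 [A ^+ 2]expr2 [D ^+ 2]expr2 !exprMn !exprVn !exprMn !exprS.
move: (Z2 ^+ h) (A ^+ h) (D ^+ h) Dh0 => z x y y0.
by field; repeat (apply/andP; split).
Qed.

Section SquareDivisibility.
Variables n d r : nat.
Hypothesis n_gt0 : (0 < n)%N.
Hypothesis d_gt3 : (3 < d)%N.
Hypothesis ndr : n.+1 = (d * r)%N.
Local Notation Phi := (PhiQ n).
Local Notation p := (qF ^+ d).
Local Notation M := (n - r)%N.

(** With y = q^(s n), each pair of factors differs from the square by a multiple of (1 - y)^2. *)
Lemma vge2_qpoch_sym (z s : int) k :
  vge Phi 2 (qpoch (qF ^ (z - s * n)) p k * qpoch (qF ^ (z + s * n)) p k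
             - qpoch (qF ^ z) p k ^+ 2).
Proof.
elim: k => [|k IHk]; first by rewrite !qpoch0 mulr1 expr1n subrr; exact: vge0.
rewrite !qpochS.
have alg (K : fieldType) (X Y Z u v w : K) :
  X * u * (Y * v) - (Z * w) ^+ 2 = (X * Y - Z ^+ 2) * (u * v) + Z ^+ 2 * (u * v - w ^+ 2).
  by ring.
rewrite alg; apply: vgeD.
  apply: vgeMr => //; rewrite -exprM exprnP -!expfzDr ?qF_neq0 //.
  by apply: vgeMr; exact: vge_one_subqFz.
apply: vgeMl; first by apply: (vgeX _ 0 2); exact: vge_qpoch.
have alg2 (K : fieldType) (a b x : K) : b != 0 ->
    (1 - a * b^-1 * x) * (1 - a * b * x) - (1 - a * x) ^+ 2
  = - (a * x * b^-1) * (1 - b) ^+ 2.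
  by move=> b0; field.
rewrite !expfzDr ?qF_neq0 // -invr_expz alg2 ?expfz_neq0 ?qF_neq0 //.
apply: vgeMl.
  rewrite invr_expz -exprM exprnP -!expfzDr ?qF_neq0 //.
  by apply: vgeN; exact: vge_qFz.
by apply: (vgeX _ 1 2); apply: vge1_one_subqFz => //; exact: dvdz_mull.
Qed.

Definition summand (k : nat) : RF :=
  qint (2 * d * k + 1) * (qpoch qF p k) ^+ d / (qpoch p p k) ^+ d
  * qF ^+ ((d * (d - 3) * k)./2).

Lemma vge_qint m : vge Phi 0 (qint m).
Proof.
rewrite /qint; apply: vgeMr; first exact: (vge_one_subqFz n n_gt0 (Posz _)).
apply: (vge_one_subqFzV n n_gt0 1); rewrite dvdzE /= dvdn1.
by have := n_gt2 n d r n_gt0 d_gt3 ndr; lia.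
Qed.

(** For k > M the factor of index M in (q; p)_k has exponent 1 + d M = (d - 1) n, and it occurs to
    the power d >= 2. *)
Lemma vge2_summand_tail k : (M < k < n)%N -> vge Phi 2 (summand k).
Proof.
move=> /andP[Mk kn]; rewrite /summand.
have d2 : (2 <= 1 * d)%N by lia.
apply: vgeMr; last exact: (vge_qFz n n_gt0 (Posz _)).
apply: vgeMr; last first.
  rewrite -exprVn -[0%N](mul0n d); apply: vgeX.
  exact: (vge_qpochpV n d r n_gt0 d_gt3 ndr).
apply: vgeMl; first exact: vge_qint.
apply: vge_le d2 _; apply: vgeX.
apply: (vge1_qpoch n d n_gt0 1 k M) => //.
have -> : 1%:Z + (d * M)%N = (d%:Z - 1) * n by nia.
exact: dvdz_mull.
Qed.

(** For s = d - 1 one has q^(1 - s n) = p^(-M). The weight takes this parameter and one q, the pair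
    with shift s takes q^(1 + s n) and one q, and the other d - 4 numerators form d/2 - 2 pairs with
    shift 0. *)
Lemma vge2_summand_lag k : ~~ odd d -> (k <= M)%N ->
  vge Phi 2 (summand k - lag_weight p qF M k *
     (wp_pair n d 0 k ^+ (d./2 - 2) * wp_pair n d (d%:Z - 1) k)).
Proof.
move=> d_even kM; have kn : (k < n)%N by exact: (ltn_of_leM n d r n_gt0 d_gt3 ndr).
set h := (d./2 - 2)%N; have dh : d = h.+2.*2.
  have := odd_double_half d; rewrite (negPf d_even) /h -!muln2; lia.
set s := d%:Z - 1.
have rn := r_lt_n n d r n_gt0 d_gt3 ndr.
have eM : 1%:Z + (d * M)%N = s * n by rewrite /s; nia.
have D0 : qpoch p p k != 0 by exact: (qpoch_pp_neq0 d (leq_trans _ d_gt3)).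
have be0 := qpochB_neq0 n d r n_gt0 d_gt3 ndr s k kn.
have de0 : qpoch (qF ^ (d%:Z - s * n)) p k != 0.
  by rewrite -mulNr; exact: (qpochB_neq0 n d r n_gt0 d_gt3 ndr (- s) k kn).
have ew : (1 - qF * p ^+ k ^+ 2) / (1 - qF) = qint (2 * d * k + 1).
  rewrite /qint; congr ((1 - _) / _).
  by rewrite -!exprM -exprS; congr (_ ^+ _); lia.
have eal : p ^- M = qF ^ (1 - s * n).
  by rewrite -exprM exprnN; congr (_ ^ _); lia.
have ebe : qF * p ^+ M.+1 = qF ^ (d%:Z + s * n).
  by rewrite -exprM -exprS exprnP; congr (_ ^ _); lia.
rewrite /summand /lag_weight /wp_pair ew eal ebe !mul0r !subr0 expr1z.
rewrite -exprnP.
have half : ((d * (d - 3) * k)./2 = h.+2 * (2 * h + 1) * k)%N.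
  have -> : (d * (d - 3) * k = (h.+2 * (2 * h + 1) * k).*2)%N.
    by rewrite dh -!muln2; nia.
  by rewrite doubleK.
(* Per unit of [k] the exponents add up to d M + (d - 1) h + d - 1 - s n; as d M = s n - 1 and h =
   d/2 - 2, this is d (d - 3) / 2. *)
have eZ : qF ^+ ((d * (d - 3) * k)./2) = p ^+ M ^+ k
    * (((qF ^ (d%:Z - 1)) ^+ k) ^+ h * (qF ^ (d%:Z - 1 - s * n)) ^+ k).
  rewrite half !exprnP !exprz_exp -!expfzDr ?qF_neq0 //; congr (_ ^ _).
  have -> : d%:Z = 2 * h%:Z + 4 by rewrite dh -muln2; lia.
  rewrite -eM dh -muln2 !PoszM; clearbody h; move: (Posz M) => m; lia.
have := wp_term_diff (qint (2 * d * k + 1)) (qpoch qF p k) (qpoch p p k)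
  (qpoch (qF ^ (1 - s * n)) p k) (qpoch (qF ^ (d%:Z + s * n)) p k)
  (qpoch (qF ^ (1 + s * n)) p k) (qpoch (qF ^ (d%:Z - s * n)) p k)
  (p ^+ M ^+ k) ((qF ^ (d%:Z - 1)) ^+ k) ((qF ^ (d%:Z - 1 - s * n)) ^+ k) h D0 be0 de0.
rewrite -dh -eZ => ->.
have vA := vge_qpoch n d n_gt0 1 k.
have vD := vge_qpochpV n d r n_gt0 d_gt3 ndr k kn.
have vbe := vge_qpochBV n d r n_gt0 d_gt3 ndr s k kn.
have vde := vge_qpochBV n d r n_gt0 d_gt3 ndr (- s) k kn.
rewrite mulNr in vde.
apply: vgeMl.
  apply: vgeMr; first apply: vgeMr.
  - exact: vge_qint.
  - exact: (vge_qFz n n_gt0 (Posz _)).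
  - by apply: (vgeX _ 0); exact: vgeMr.
apply: vgeMr; last first.
  apply: vgeMr vde; apply: vgeMr vbe; exact: vgeMr.
(* Both products are compared with A^2 D^2, so that the symmetric shifts apply to numerators and
   denominators separately. *)
have alg (K : fieldType) (al be ga de A D : K) :
    be * de * A ^+ 2 - al * ga * D ^+ 2
  = (de * be - D ^+ 2) * A ^+ 2 - (al * ga - A ^+ 2) * D ^+ 2 by ring.
rewrite alg; apply: vgeB; apply: vgeMr.
- exact: vge2_qpoch_sym.
- exact: (vgeX _ 0 2).
- exact: vge2_qpoch_sym 1 s k.
- by apply: (vgeX _ 0 2); exact: (vge_qpoch n d n_gt0 d).
Qed.

Lemma vge2_sum : ~~ odd d -> vge Phi 2 (\sum_(k < n) summand k).
Proof.
move=> d_even; rewrite -(big_mkord xpredT summand).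
have rn := r_lt_n n d r n_gt0 d_gt3 ndr.
have r0 : (0 < r)%N by case: r ndr; lia.
rewrite (big_cat_nat (n := M.+1)) //=; last by lia.
apply: vgeD; last first.
  rewrite big_seq_cond; apply: vge_sum => k /andP[]; rewrite mem_index_iota => ? _.
  exact: vge2_summand_tail.
pose F k := wp_pair n d 0 k ^+ (d./2 - 2) * wp_pair n d (d%:Z - 1) k.
have -> : \sum_(0 <= k < M.+1) summand k
        = \sum_(k < M.+1) (summand k - lag_weight p qF M k * F k) + lag p qF M F.
  by rewrite big_mkord sumrB /lag subrK.
apply: vgeD.
  by apply: vge_sum => k _; apply: vge2_summand_lag => //; rewrite -ltnS.
have hF : nodepoly n d M (r.-1 * (d./2 - 2) + r.-1) F.
  apply: nodepolyM; first apply: nodepolyX;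
    exact: (nodepoly_wp_pair n d r n_gt0 d_gt3 ndr).
apply: (vge2_lag n d n_gt0 _ M _ F _ _ hF); first exact: leq_trans d_gt3.
  (* The degree is at most (d - 3) (r - 1), which is less than M = (d - 1) r - 1. *)
  have : (d./2 - 2 <= d - 4)%N by lia.
  move: (d./2 - 2)%N => h hd; case: r r0 ndr rn {hF} => // r' _ /= *; nia.
have -> : (1 + d * M = (d - 1) * n)%N by nia.
exact: dvdn_mull.
Qed.
End SquareDivisibility.

Theorem theorem2 (d n : nat) :
  (4 <= d)%N -> ~~ odd d -> (0 < n)%N -> (n.+1 %% d = 0)%N ->
  cong_mod
    (\sum_(k < n)
       qint (2 * d * k + 1)
       * (qpoch qF (qF ^+ d) k) ^+ d / (qpoch (qF ^+ d) (qF ^+ d) k) ^+ d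
       * qF ^+ ((d * (d - 3) * k)./2))
    0 (PhiQ n ^+ 2).
Proof.
move=> d4 d_even n0 /eqP/dvdnP[r]; rewrite mulnC => ndr.
have [u [v [cv v0 e]]] := vge2_sum n d r n0 d4 ndr d_even.
(* Coprimality to Phi_n passes to its square. *)
by exists u, v; rewrite coprimep_expr // subr0.
Qed.
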